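(* Consider the shifted mean detection problem with $\mathcal{C}$ the class of all perfect matchings of the complete balanced bipartite graph with $2\sqrt d$ nodes, put $\tau=\sqrt{\log(1/\xi)/n}$, and let $\delta$ be a sufficiently small positive constant. Let $T\ge1$ with $T=O(d^{\eta})$, where $\eta$ is any constant. Then $$\frac{T\cdot\sup_{q\in\mathcal{Q}}|\mathcal{C}(q)|}{|\mathcal{C}|}=o(1)$$ under either of the following settings: (i) $\tau^2/\alpha^2=o(1)$ and $\tau^2/(2d^{\delta}\alpha^2\beta^{*2})\to\infty$; (ii) $\lim_{d\to\infty}\tau^2/\alpha^2>0$ and $\beta^*=o(d^{-\delta})$.
   Context: Setting: $\sqrt d$ is an integer and each coordinate $j=(k-1)\sqrt d+k'$ ($k,k'\in[\sqrt d]$) of $[d]$ is identified with the edge between node $k$ of one part and node $k'$ of the other part of the complete bipartite graph with $\sqrt d$ nodes on each side; a perfect matching is thus a subset $\mathcal{S}\subseteq[d]$ with $|\mathcal{S}|=s^*=\sqrt d$. $\mathbb{P}_0=N(\mathbf{0},\mathbf{I}_d)$; for $\mathcal{S}\in\mathcal{C}$, $\mathbb{P}_{\mathcal{S}}=(1-\alpha)N(\mathbf{0},\mathbf{I}_d)+\alpha N(\boldsymbol{\theta}_{\mathcal{S}},\mathbf{I}_d)$ (mixture), where $\alpha\in(0,1]$, $(\boldsymbol{\theta}_{\mathcal{S}})_j=\beta^*>0$ for $j\in\mathcal{S}$ and $0$ otherwise. Asymptotics: $n,\alpha,\beta^*,\xi,T$ are sequences indexed by $d\to\infty$ with $n\to\infty$,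 $\alpha n\to\infty$, $\beta^*=o(1)$, $\xi\in[0,1/4)$; limits of all sequences considered are assumed to exist (in $[0,\infty]$). Queries: fix $b>0$; $\mathcal{Q}$ is the set of all (measurable) functions $q:\mathbb{R}^d\to[-b,b]$. For $q\in\mathcal{Q}$, $\mathcal{C}(q)=\{\mathcal{S}\in\mathcal{C}: |\mathbb{E}_{\mathbb{P}_{\mathcal{S}}}[q(\boldsymbol{X})]-\mathbb{E}_{\mathbb{P}_0}[q(\boldsymbol{X})]|>\overline{\tau}_q\}$, where $\overline{\tau}_q=\max\{\frac{2b}{3}\cdot\frac{\log(1/\xi)}{n},\sqrt{2\,\mathrm{Var}_{\mathbb{P}_0}[q(\boldsymbol{X})]\log(1/\xi)/n}\}$ ($\overline{\tau}_q=\tau=+\infty$ if $\xi=0$). *)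

(* Defs.v *)
From HB Require Import structures.
From mathcomp Require Import all_boot all_order all_algebra.
From mathcomp Require Import all_classical all_reals all_analysis.

Set Implicit Arguments.
Unset Strict Implicit.
Unset Printing Implicit Defensive.

Import Order.TTheory GRing.Theory Num.Theory.
Import numFieldNormedType.Exports.

Local Open Scope classical_set_scope.
Local Open Scope ring_scope.

(* R^n, with its Borel sigma-algebra (the product one) *)
Notation vec R n := (n%N.-tuple (measurableTypeR R)).

Section GaussianVector.
Variable R : realType.

Definition vec_cons n (x : measurableTypeR R * vec R n) : vec R n.+1 :=
  [tuple of x.1 :: x.2].

Lemma measurable_vec_cons n : measurable_fun setT (@vec_cons n).
Proof. exact: measurable_cons. Qed.

HB.instance Definition _ n :=
  isMeasurableFun.Build _ _ _ _ (@vec_cons n) (@measurable_vec_cons n).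

(* N(theta, I_n), as the product of the one-dimensional laws N(theta_i, 1);
   the second argument of normal_prob is a standard deviation. *)
Fixpoint gaussian n : vec R n -> probability (vec R n) R :=
  if n is n'.+1 then fun theta =>
    distribution (normal_prob (thead theta) 1 \x
                  gaussian ([tuple of behead theta] : vec R n'))%E
                 (@vec_cons n')
  else fun=> \d_([tuple] : vec R 0).

End GaussianVector.

Section Mixture.
Context d (T : measurableType d) (R : realType).
Variables (a : {i01 R}) (P Q : probability T R).

Definition mixture : set T -> \bar R :=
  measure_add (mscale (1 - a%:num)%:nng P) (mscale a%:num%:nng Q).

HB.instance Definition _ := Measure.on mixture.

Let mixture_setT : mixture setT = 1%E.
Proof.
transitivity ((1 - a%:num)%:E * P setT + a%:num%:E * Q setT)%E.
  exact: measure_addE.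
by rewrite !probability_setT !mule1 -EFinD subrK.
Qed.

HB.instance Definition _ :=
  Measure_isProbability.Build _ _ _ mixture mixture_setT.

End Mixture.

(* K_{m,m}: inl k and inr k' are the nodes of the two parts.  With 0-based
   indices, coordinate j = k * m + k' of R^(m ^ 2) is the edge {inl k, inr k'}. *)
Definition incident m (v : 'I_m + 'I_m) (j : 'I_(m ^ 2)) : bool :=
  match v with
  | inl k => j %/ m == k
  | inr k' => j %% m == k'
  end%N.

Definition perfect_matching m (S : {set 'I_(m ^ 2)}) : bool :=
  [forall v : 'I_m + 'I_m, #|[set j in S | incident v j]| == 1%N].

Definition perfect_matchings m : {set {set 'I_(m ^ 2)}} :=
  [set S | perfect_matching S].

Section Detection.
Variable R : realType.

Definition null_law d : probability (vec R d) R :=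
  gaussian [tuple 0 | _ < d].

Definition shifted_mean d (beta : R) (S : {set 'I_d}) : vec R d :=
  [tuple if j \in S then beta else 0 | j < d].

Definition alt_law d (alpha : {i01 R}) (beta : R) (S : {set 'I_d}) :
    probability (vec R d) R :=
  mixture alpha (null_law d) (gaussian (shifted_mean beta S)).

Definition queries d (b : R) : set (vec R d -> R) :=
  [set q | measurable_fun setT q /\ forall x, - b <= q x <= b].

Definition tau (n : nat) (xi : R) : \bar R :=
  if xi == 0 then +oo%E else (Num.sqrt (ln xi^-1 / n%:R))%:E.

(* The variance of a bounded query is finite, so that fine is harmless. *)
Definition tau_query d (b : R) (n : nat) (xi : R) (q : vec R d -> R) :
    \bar R :=
  if xi == 0 then +oo%E else
  (Num.max (2 * b / 3 * (ln xi^-1 / n%:R))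
           (Num.sqrt (2 * fine 'V_(null_law d)[q] * ln xi^-1 / n%:R)))%:E.

(* C(q) *)
Definition distinguished (m : nat) (b : R) (n : nat) (xi : R) (alpha : {i01 R})
    (beta : R) (q : vec R (m ^ 2) -> R) : {set {set 'I_(m ^ 2)}} :=
  [set S in perfect_matchings m |
    (tau_query b n xi q <
       `|'E_(alt_law alpha beta S)[q] - 'E_(null_law (m ^ 2))[q]|)%E].

Definition sup_distinguished (m : nat) (b : R) (n : nat) (xi : R) (alpha : {i01 R})
    (beta : R) : R :=
  sup [set #|distinguished b n xi alpha beta q|%:R | q in @queries (m ^ 2) b].

End Detection.

(* Main.v *)
Require Import Defs.
From HB Require Import structures.
From mathcomp Require Import all_boot all_order all_algebra.
From mathcomp Require Import fingroup perm.
From mathcomp Require Import all_classical all_reals all_analysis.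
From mathcomp Require Import measurable_realfun zify ring lra.

Set Implicit Arguments.
Unset Strict Implicit.
Unset Printing Implicit Defensive.

Import Order.TTheory GRing.Theory Num.Theory.
Import numFieldNormedType.Exports.

Local Open Scope ring_scope.

(* With L_S the likelihood ratio of N(theta_S, I) to N(0, I), one has
   E_0[L_S L_S'] = exp(beta^2 |S :&: S'|), so for a set A of matchings that all
   shift the mean of q in the same direction by more than tau_q, Cauchy-Schwarz
   applied to q and the sum of the L_S over A gives
     (|A| tau_q)^2 <=
       alpha^2 Var(q) sum_(S, S' in A) (exp(beta^2 |S :&: S'|) - 1),
   while tau_q^2 >= 2 tau^2 Var(q).  A matching is a permutation, and the
   overlap of two random ones has exponential moments bounded uniformly in m.
   Truncating the overlap at u = d^delta, for which both settings give
   tau^2 >= alpha^2 beta^2 u eventually, yields |C(q)| / |C| = O(u^-(r+1)) for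
   every r, which beats any polynomial T. *)

(** * Perfect matchings as permutations *)

Lemma edge_subproof m (i k : 'I_m) : (i * m + k < m ^ 2)%N.
Proof.
have := ltn_ord i; have := ltn_ord k; rewrite -mulnn; nia.
Qed.

Definition edge m (i k : 'I_m) : 'I_(m ^ 2) := Ordinal (edge_subproof i k).

Lemma edge_div m (i k : 'I_m) : (edge i k %/ m = i)%N.
Proof.
have m0 : (0 < m)%N by case: m i k => [[]|].
by rewrite /= divnMDl// divn_small ?addn0.
Qed.

Lemma edge_mod m (i k : 'I_m) : (edge i k %% m = k)%N.
Proof. by rewrite /= modnMDl modn_small. Qed.

Lemma edge_inj m (i i' k k' : 'I_m) : edge i k = edge i' k' -> i = i' /\ k = k'.
Proof.
move=> e; split; apply: val_inj => /=.
  by rewrite -(edge_div i k) e edge_div.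
by rewrite -(edge_mod i k) e edge_mod.
Qed.

Lemma edgeP m (j : 'I_(m ^ 2)) : exists i k, j = edge i k.
Proof.
have m0 : (0 < m)%N by case: m j => // -[].
have im : (j %/ m < m)%N by rewrite ltn_divLR// mulnn.
have km : (j %% m < m)%N by rewrite ltn_mod.
exists (Ordinal im), (Ordinal km); apply: val_inj.
by rewrite /= -divn_eq.
Qed.

Definition matching_of_perm m (s : {perm 'I_m}) : {set 'I_(m ^ 2)} :=
  [set edge i (s i) | i : 'I_m].

Lemma mem_matching_of_perm m (s : {perm 'I_m}) (i k : 'I_m) :
  (edge i k \in matching_of_perm s) = (s i == k).
Proof.
by apply/imsetP/eqP => [[i' _ /edge_inj[-> ->]//]|<-]; exists i.
Qed.

Lemma matching_of_perm_inj m : injective (@matching_of_perm m).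
Proof.
move=> s t st; apply/permP => i; apply/eqP.
by rewrite eq_sym -mem_matching_of_perm -st mem_matching_of_perm.
Qed.

Definition agreement m (s t : {perm 'I_m}) : {set 'I_m} :=
  [set i | s i == t i].

Lemma card_matching_of_permI m (s t : {perm 'I_m}) :
  #|matching_of_perm s :&: matching_of_perm t| = #|agreement s t|.
Proof.
rewrite -(@card_imset _ _ (fun i => edge i (s i))); last first.
  by move=> i i' /edge_inj[].
apply: eq_card => j; have [i [k ->]] := edgeP j.
rewrite inE !mem_matching_of_perm; apply/andP/imsetP.
  by move=> [/eqP <- /eqP ti]; exists i; rewrite // inE ti.
move=> [i']; rewrite inE => /eqP sti /edge_inj[-> ->].
by split=> //; rewrite sti.
Qed.

Lemma perfect_matching_of_perm m (s : {perm 'I_m}) :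
  perfect_matching (matching_of_perm s).
Proof.
apply/forallP => -[i|k]; apply/cards1P.
  exists (edge i (s i)); apply/setP => j; have [i' [k' ->]] := edgeP j.
  rewrite !inE mem_matching_of_perm /incident edge_div.
  apply/andP/eqP => [[/eqP <- /eqP/val_inj->]//|/edge_inj[-> ->]].
  by rewrite !eqxx.
exists (edge (s^-1%g k) k); apply/setP => j; have [i' [k' ->]] := edgeP j.
rewrite !inE mem_matching_of_perm /incident edge_mod.
apply/andP/eqP => [[/eqP <- /eqP/val_inj<-]|/edge_inj[-> ->]].
  by rewrite permK.
by rewrite permKV !eqxx.
Qed.

(** The unique edge of [S] at each left node defines a map [f] on ['I_m]. Uniqueness at the right
    nodes makes [f] injective, hence a permutation. *)
Lemma perfect_matching_perm m (S : {set 'I_(m ^ 2)}) :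
  perfect_matching S -> exists s : {perm 'I_m}, S = matching_of_perm s.
Proof.
move=> /forallP pmS.
have /choice[f fS] (i : 'I_m) :
    exists l : 'I_m, forall k, (edge i k \in S) = (l == k).
  have /cards1P[j Sj] := pmS (inl i).
  have [i' [l jE]] := edgeP j; exists l => k.
  have jS : edge i' l \in [set j in S | incident (inl i) j].
    by rewrite Sj jE inE.
  move: jS; rewrite !inE /incident edge_div => /andP[lS /eqP/val_inj ii'].
  move: lS jE; rewrite ii' => lS jE.
  apply/idP/eqP => [kS|<-//].
  have : edge i k \in [set j in S | incident (inl i) j].
    by rewrite !inE kS /incident edge_div eqxx.
  by rewrite Sj jE inE => /eqP/edge_inj[].
have f_inj : injective f.
  move=> i i' fii'.
  have /cards1P[j Sj] := pmS (inr (f i)).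
  have : edge i (f i) \in [set j in S | incident (inr (f i)) j].
    by rewrite !inE fS /incident edge_mod !eqxx.
  have : edge i' (f i) \in [set j in S | incident (inr (f i)) j].
    by rewrite !inE fS /incident edge_mod fii' !eqxx.
  by rewrite Sj !inE => /eqP<- /eqP/edge_inj[].
exists (perm f_inj); apply/setP => j; have [i [k ->]] := edgeP j.
by rewrite fS mem_matching_of_perm permE.
Qed.

Lemma perfect_matchingsE m :
  perfect_matchings m = @matching_of_perm m @: [set: {perm 'I_m}].
Proof.
apply/setP => S; rewrite inE; apply/idP/imsetP => [|[s _ ->]].
  by move=> /perfect_matching_perm[s ->]; exists s; rewrite ?inE.
exact: perfect_matching_of_perm.
Qed.

Lemma card_perfect_matchings m : #|perfect_matchings m| = (m`!)%N.
Proof.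
rewrite perfect_matchingsE card_imset; last exact: matching_of_perm_inj.
by rewrite cardsT card_Sn.
Qed.

(** * Exponential moments of the overlap of two matchings *)

(** Right multiplication by [s] is a bijection from the permutations fixing [B] pointwise, that is,
    those supported on [~: B], onto those agreeing with [s] on [B]. *)
Lemma card_perm_agree m (s : {perm 'I_m}) (B : {set 'I_m}) :
  #|[set t : {perm 'I_m} | B \subset agreement s t]| = ((m - #|B|)`!)%N.
Proof.
have <- : #|~: B| = (m - #|B|)%N by rewrite cardsCs finset.setCK card_ord.
rewrite -card_perm -[RHS](card_imset _ (mulIg s)).
apply: eq_card => t; apply/idP/imsetP.
  rewrite inE => /fintype.subsetP agree.
  exists (t * s^-1)%g; last by rewrite mulgKV.
  apply/fintype.subsetP => i; rewrite !inE; apply: contraNN => iB.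
  by have := agree i iB; rewrite inE permM => /eqP<-; rewrite permK.
move=> [u uB ->]; rewrite inE; apply/fintype.subsetP => i iB; rewrite inE permM.
have ui : u i = i by apply: (out_perm uB); rewrite inE iB.
by rewrite ui.
Qed.

(* The factorial moments of order k <= m of the number of fixed points of a
   uniform permutation are 1, as for a Poisson variable. *)
Lemma sum_bin_agree m (s : {perm 'I_m}) k : (k <= m)%N ->
  (\sum_(t : {perm 'I_m}) 'C(#|agreement s t|, k) * k`! = m`!)%N.
Proof.
move=> km; rewrite -big_distrl /=.
(* Double counting: the binomial counts the sets [B] of size [k] inside the agreement set, and
   exchanging the sums counts, for each [B], the permutations agreeing with [s] on it. *)
under eq_bigr do rewrite -cards_draws -sum1dep_card.
under eq_bigr do rewrite big_mkcondl.
rewrite exchange_big/=.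
under eq_bigr => B /eqP Bk.
  rewrite -big_mkcond sum1dep_card card_perm_agree Bk; over.
rewrite sum_nat_cond_const -sum1dep_card.
rewrite sum1dep_card card_draws card_ord -mulnA [((m - k)`! * _)%N]mulnC.
exact: bin_fact.
Qed.

Lemma sum_le_expR (R : realType) (z : R) n : 0 <= z ->
  \sum_(k < n) z ^+ k / k`!%:R <= expR z.
Proof.
move=> z0; rewrite -(big_mkord predT (fun k => z ^+ k / k`!%:R)).
apply: (nondecreasing_cvgn_le _ (is_cvg_series_exp_coeff z)).
apply/nondecreasing_seqP => k; rewrite /series/= big_nat_recr//= lerDl.
exact: exp_coeff_ge0.
Qed.

(** After a binomial expansion, the factorial moments make the term of order [k] average to
    [z ^+ k / k!]. What remains is a partial sum of the exponential series, whence a bound uniform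
    in [m]. *)
Lemma sum_expr_agree (R : realType) m (s : {perm 'I_m}) (z : R) : 0 <= z ->
  \sum_(t : {perm 'I_m}) (z + 1) ^+ #|agreement s t| <=
  m`!%:R * expR z.
Proof.
move=> z0.
(* Padding the expansion with vanishing binomials up to order [m] makes its range independent of
   [A], so that the sums can be exchanged. *)
have expand (A : {set 'I_m}) :
    (z + 1) ^+ #|A| = \sum_(k < m.+1) z ^+ k * 'C(#|A|, k)%:R.
  have Am : (#|A|.+1 <= m.+1)%N by rewrite ltnS -[m in leqRHS]card_ord max_card.
  rewrite exprD1n (big_ord_widen _ (fun k => z ^+ k *+ 'C(#|A|, k)) Am).
  rewrite big_mkcond; apply: eq_bigr => k _; rewrite ltnS mulr_natr.
  by case: leqP => // /bin_small ->.
under eq_bigr do rewrite expand.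
have fact0 : 0 < m`!%:R :> R by rewrite ltr0n fact_gt0.
rewrite exchange_big /= -ler_pdivrMl//; apply: le_trans (sum_le_expR m.+1 z0).
rewrite mulr_sumr; apply: ler_sum => k _.
rewrite -mulr_sumr -natr_sum mulrCA -(sum_bin_agree s (ltn_ord k)).
rewrite -big_distrl/= natrM invfM mulrAC mulVf ?mul1r//.
(* The cancelled sum of binomials is nonzero because its product with [k!] is [m!]. *)
by have := fact_gt0 m; rewrite -(sum_bin_agree s (ltn_ord k)) -big_distrl/=
  muln_gt0 pnatr_eq0 -lt0n => /andP[].
Qed.

Lemma sum_expr_matchingI (R : realType) m (S : {set 'I_(m ^ 2)}) (z : R) :
  S \in perfect_matchings m -> 0 <= z ->
  \sum_(S' in perfect_matchings m) (z + 1) ^+ #|S :&: S'| <=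
  #|perfect_matchings m|%:R * expR z.
Proof.
rewrite card_perfect_matchings perfect_matchingsE => /imsetP[s _ ->] z0.
rewrite big_imset/=; last by move=> t t' _ _; exact: matching_of_perm_inj.
under eq_bigr do rewrite card_matching_of_permI.
by rewrite big_set/=; exact: sum_expr_agree.
Qed.

(** * Change of measure between Gaussian laws *)

Local Open Scope classical_set_scope.

(** The Radon-Nikodym derivative and [normal_pdf] have the same integral over every measurable set,
    so they agree almost everywhere. *)
Lemma ge0_integral_normal_prob (R : realType) (m s : R) (f : R -> \bar R) :
  measurable_fun setT f -> (forall x, 0 <= f x)%E ->
  (\int[normal_prob m s]_x f x =
   \int[lebesgue_measure]_x (f x * (normal_pdf m s x)%:E))%E.
Proof.
move=> mf f0.
have dom : (normal_prob m s : {finite_measure set _ -> \bar R})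
    `<< (lebesgue_measure : {sigma_finite_measure set _ -> \bar R}).
  exact: normal_prob_dominates.
rewrite -(Radon_Nikodym_SigmaFinite.change_of_variables dom)//.
have intF := Radon_Nikodym_SigmaFinite.f_integrable dom.
apply: ae_eq_integral => //.
- by apply: emeasurable_funM => //; exact: measurable_int intF.
- apply: emeasurable_funM => //; apply/measurable_EFinP.
  exact: measurable_normal_pdf.
- apply: ae_eqe_mul2l; apply: integral_ae_eq => //.
  + by apply/measurable_EFinP; exact: measurable_normal_pdf.
  + by move=> E _ mE; rewrite -Radon_Nikodym_SigmaFinite.f_integral.
Qed.

Lemma normal_pdf_tilt (R : realType) (t x : R) :
  normal_pdf t 1 x = expR (t * x - t ^+ 2 / 2) * normal_pdf 0 1 x.
Proof.
rewrite !normal_pdfE ?oner_eq0// mulrCA; congr (_ * _).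
rewrite /normal_fun -expRD; congr expR.
by rewrite expr1n subr0 -mulr_natl; field.
Qed.

Lemma measurable_tilt (R : realType) (t : R) :
  measurable_fun setT (fun x : R => (expR (t * x - t ^+ 2 / 2))%:E).
Proof.
apply/measurable_EFinP; apply: measurableT_comp => //.
by apply: measurable_funB => //; exact: measurable_funM.
Qed.

Lemma ge0_integral_normal_prob_tilt (R : realType) (t : R) (f : R -> \bar R) :
  measurable_fun setT f -> (forall x, 0 <= f x)%E ->
  (\int[normal_prob t 1]_x f x =
   \int[normal_prob 0 1]_x (f x * (expR (t * x - t ^+ 2 / 2))%:E))%E.
Proof.
move=> mf f0; rewrite (ge0_integral_normal_prob t 1 mf f0).
rewrite (@ge0_integral_normal_prob _ 0 1).
- by apply: eq_integral => x _; rewrite normal_pdf_tilt EFinM muleA.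
- by apply: emeasurable_funM => //; exact: measurable_tilt.
- by move=> x; rewrite mule_ge0// lee_fin expR_ge0.
Qed.

(** The density of N(theta, I) with respect to N(0, I), an exponential tilt. *)
Definition likelihood_ratio (R : realType) n (theta x : vec R n) : R :=
  expR (\sum_(i < n) (tnth theta i * tnth x i - tnth theta i ^+ 2 / 2)).

Lemma measurable_likelihood_ratio (R : realType) n (theta : vec R n) :
  measurable_fun setT (likelihood_ratio theta).
Proof.
apply: measurableT_comp => //; apply: measurable_sum => i.
apply: measurable_funB => //; apply: measurable_funM => //.
exact: measurable_tnth.
Qed.

Lemma likelihood_ratio_cons (R : realType) n (theta : vec R n.+1)
    (x : measurableTypeR R * vec R n) :
  likelihood_ratio theta (vec_cons x) =
  likelihood_ratio [tuple of behead theta] x.2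
    * expR (thead theta * x.1 - thead theta ^+ 2 / 2).
Proof.
case/tupleP: theta => t theta; rewrite /likelihood_ratio big_ord_recl expRD.
rewrite mulrC; congr (expR _ * _).
by apply: eq_bigr => i _; rewrite !(tnth_nth 0).
Qed.

Lemma ge0_integral_gaussianS (R : realType) n (theta : vec R n.+1)
    (f : vec R n.+1 -> \bar R) :
  measurable_fun setT f -> (forall x, 0 <= f x)%E ->
  (\int[gaussian theta]_x f x =
   \int[gaussian [tuple of behead theta]]_y
     \int[normal_prob (thead theta) 1]_x f (vec_cons (x, y)))%E.
Proof.
move=> mf f0.
have mfc : measurable_fun setT (f \o @vec_cons R n).
  by apply: measurableT_comp => //; exact: measurable_vec_cons.
transitivity (\int[(normal_prob (thead theta) 1 \x
   gaussian [tuple of behead theta])%E]_z (f \o @vec_cons R n) z)%E.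
  exact: ge0_integral_distribution.
by rewrite fubini_tonelli2// => z; exact: f0.
Qed.

(** Induction on the dimension: Tonelli splits off the first coordinate, which is handled by the
    one-dimensional tilt, and the induction hypothesis treats the others. *)
Lemma ge0_integral_gaussian (R : realType) n (theta : vec R n)
    (f : vec R n -> \bar R) :
  measurable_fun setT f -> (forall x, 0 <= f x)%E ->
  (\int[gaussian theta]_x f x =
   \int[null_law R n]_x (f x * (likelihood_ratio theta x)%:E))%E.
Proof.
elim: n theta f => [|n IHn] theta f mf f0.
  rewrite /null_law /= !integral_dirac//; last first.
    apply: emeasurable_funM => //; apply/measurable_EFinP.
    exact: measurable_likelihood_ratio.
  by rewrite /likelihood_ratio big_ord0 expR0 mule1.
have mfL (t : vec R n.+1) :
    measurable_fun setT (fun x => f x * (likelihood_ratio t x)%:E)%E.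
  apply: emeasurable_funM => //; apply/measurable_EFinP.
  exact: measurable_likelihood_ratio.
have fL0 (t x : vec R n.+1) : (0 <= f x * (likelihood_ratio t x)%:E)%E.
  by rewrite mule_ge0// lee_fin expR_ge0.
have null_behead :
    [tuple of behead [tuple (0 : R) | _ < n.+1]] = [tuple 0 | _ < n].
  by apply: eq_from_tnth => i; rewrite tnth_behead !tnth_mktuple.
have null_thead : thead [tuple (0 : R) | _ < n.+1] = 0.
  by rewrite /thead tnth_mktuple.
rewrite /null_law [RHS]ge0_integral_gaussianS//.
rewrite null_behead null_thead -/(null_law R n).
have mfc : measurable_fun setT (f \o @vec_cons R n).
  by apply: measurableT_comp => //; exact: measurable_vec_cons.
rewrite (ge0_integral_gaussianS theta mf f0) IHn; last 2 first.
- apply: (measurable_fun_fubini_tonelli_G (f \o @vec_cons R n) mfc) => z.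
  exact: f0.
- by move=> y; apply: integral_ge0 => x _; exact: f0.
apply: eq_integral => y _.
have mfy : measurable_fun setT (fun x => f (vec_cons (x, y))).
  exact: measurableT_comp mfc (measurable_pair2 y).
rewrite (ge0_integral_normal_prob_tilt _ mfy) => [|x]; last exact: f0.
rewrite -ge0_integralZr//; last 3 first.
- by apply: emeasurable_funM => //; exact: measurable_tilt.
- by move=> x _; rewrite mule_ge0// lee_fin expR_ge0.
- by rewrite lee_fin expR_ge0.
apply: eq_integral => x _.
by rewrite likelihood_ratio_cons EFinM -muleA; congr mule; exact: muleC.
Qed.

(** * Second moments of likelihood ratios *)

Definition dotp (R : realType) n (u v : vec R n) : R :=
  \sum_(i < n) tnth u i * tnth v i.

(** Completing the square turns a product of tilts into the tilt by the sum of the means, up to a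
    constant. As every tilt has mean 1 under the null law, that constant is the mixed second
    moment. *)
Lemma likelihood_ratioM (R : realType) n (u v x : vec R n) :
  likelihood_ratio u x * likelihood_ratio v x =
  expR (dotp u v) * likelihood_ratio [tuple tnth u i + tnth v i | i < n] x.
Proof.
have exponentE (s t y : R) : s * y - s ^+ 2 / 2 + (t * y - t ^+ 2 / 2) =
  s * t + ((s + t) * y - (s + t) ^+ 2 / 2) by field.
rewrite /likelihood_ratio -!expRD; congr expR.
rewrite /dotp -!big_split; apply: eq_bigr => i _.
by rewrite tnth_mktuple; exact: exponentE.
Qed.

Lemma expectation_likelihood_ratio (R : realType) n (u : vec R n) :
  ('E_(null_law R n)[likelihood_ratio u] = 1)%E.
Proof.
rewrite -[RHS](expectation_cst (gaussian u)) [in RHS]unlock.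
rewrite ge0_integral_gaussian//; last exact: (measurable_cst (1%:E : \bar R)).
by rewrite unlock; apply: eq_integral => x _; rewrite /= mul1e.
Qed.

Lemma expectation_likelihood_ratioM (R : realType) n (u v : vec R n) :
  ('E_(null_law R n)[(likelihood_ratio u \* likelihood_ratio v)%R] =
   (expR (dotp u v))%:E)%E.
Proof.
have -> : likelihood_ratio u \* likelihood_ratio v =
    expR (dotp u v) \o* likelihood_ratio [tuple tnth u i + tnth v i | i < n].
  by apply/funext => x /=; rewrite likelihood_ratioM mulrC.
rewrite unlock /=; under eq_integral do rewrite EFinM muleC.
rewrite ge0_integralZl//.
- have := expectation_likelihood_ratio [tuple tnth u i + tnth v i | i < n].
  by rewrite unlock => ->; rewrite mule1.
- by apply/measurable_EFinP; exact: measurable_likelihood_ratio.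
- by move=> x _; rewrite lee_fin expR_ge0.
Qed.

(** * Bounded queries: integrability, expectations and covariances *)

Lemma Lfun2_sqr d (T : measurableType d) (R : realType)
    (mu : {measure set T -> \bar R}) (f : T -> R) :
  measurable_fun setT f -> (\int[mu]_x (f x ^+ 2)%:E < +oo)%E ->
  f \in Lfun mu 2%:E.
Proof.
move=> mf ffin; rewrite inE/=; apply/andP; split; rewrite inE//=.
rewrite /finite_norm unlock poweR_lty//.
by under eq_integral => x _ do rewrite /= powR_mulrn// real_normK ?num_real//.
Qed.

Lemma likelihood_ratio_Lfun2 (R : realType) n (u : vec R n) :
  likelihood_ratio u \in Lfun (null_law R n) 2%:E.
Proof.
apply: Lfun2_sqr; first exact: measurable_likelihood_ratio.
have := expectation_likelihood_ratioM u u.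
by rewrite unlock => /= ->; rewrite ltry.
Qed.

Lemma query_Lfun2 (R : realType) n (b : R) (P : probability (vec R n) R) q :
  @queries R n b q -> q \in Lfun P 2%:E.
Proof.
move=> [mq qb]; apply: Lfun2_sqr => //.
apply: (@le_lt_trans _ _ (\int[P]_x (b ^+ 2)%:E)%E).
  apply: ge0_le_integral => //.
  - by move=> x _; rewrite lee_fin sqr_ge0.
  - by apply/measurable_EFinP; exact: measurable_funX.
  - by move=> x _; have /andP[? ?] := qb x; rewrite lee_fin; nra.
by have := expectation_cst P (b ^+ 2); rewrite unlock /= => ->; rewrite ltry.
Qed.

Lemma probability_Lfun12 d (T : measurableType d) (R : realType)
    (P : probability T R) : {subset Lfun P 2%:E <= Lfun P 1}.
Proof. by apply: Lfun_subset12; exact: fin_num_measure. Qed.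

(** The change of measure is stated for nonnegative integrands, so it is applied to [q + b]. The two
    contributions of [b] cancel since the likelihood ratio has mean 1. *)
Lemma expectation_gaussian (R : realType) n (u : vec R n) (b : R) q :
  @queries R n b q ->
  ('E_(gaussian u)[q] = 'E_(null_law R n)[(q \* likelihood_ratio u)%R])%E.
Proof.
move=> Qq; have [mq qb] := Qq.
have L1 := probability_Lfun12 (likelihood_ratio_Lfun2 u).
have q1 := probability_Lfun12 (query_Lfun2 (gaussian u) Qq).
have qL1 := Lfun2_mul_Lfun1 (query_Lfun2 (null_law R n) Qq)
                            (likelihood_ratio_Lfun2 u).
have : ('E_(gaussian u)[(q \+ cst b)%R] =
   'E_(null_law R n)[(q \* likelihood_ratio u
                      \+ b \o* likelihood_ratio u)%R])%E.
  rewrite [in LHS]unlock ge0_integral_gaussian//.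
  - rewrite unlock; apply: eq_integral => x _.
    by rewrite -EFinM /= mulrDl [b * _]mulrC.
  - by apply/measurable_EFinP; exact: measurable_funD.
  - by move=> x; have /andP[? ?] := qb x; rewrite lee_fin/=; lra.
rewrite !expectationD//; last 2 first.
- exact: Lfun_scale.
- exact: Lfun_cst.
rewrite expectationZl// expectation_likelihood_ratio expectation_cst mule1.
by move/(congr1 (fun z => z - b%:E)%E); rewrite !addeK.
Qed.

Lemma expectation_big d (T : measurableType d) (R : realType)
    (P : probability T R) (I : finType) (A : {set I}) (X : I -> T -> R) :
  (forall i, X i \in Lfun P 1) ->
  ('E_P[\sum_(i in A) X i] = \sum_(i in A) 'E_P[X i])%E.
Proof.
move=> X1; have := @expectation_sum _ _ _ P [seq X i | i <- enum A].
by rewrite !big_map !big_enum; apply => _ /mapP[i _ ->].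
Qed.

(** The one-sided bound [covariance_le], applied to both [X] and [- X], controls the absolute value
    of the covariance. *)
Lemma covariance_sqr_le d (T : measurableType d) (R : realType)
    (P : probability T R) (X Y : T -> R) :
  X \in Lfun P 2%:E -> Y \in Lfun P 2%:E ->
  fine (covariance P X Y) ^+ 2 <= fine 'V_P[X]%E * fine 'V_P[Y]%E.
Proof.
move=> X2 Y2.
have X1 := probability_Lfun12 X2; have Y1 := probability_Lfun12 Y2.
have XY1 := Lfun2_mul_Lfun1 X2 Y2.
have cov_le (Z : T -> R) : Z \in Lfun P 2%:E -> (Z * Y)%R \in Lfun P 1 ->
    fine (covariance P Z Y) <= Num.sqrt (fine 'V_P[Z]%E * fine 'V_P[Y]%E).
  move=> Z2 ZY1; have := covariance_le Z2 Y2.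
  have Z1 := probability_Lfun12 Z2.
  rewrite -(fineK (covariance_fin_num Z1 Y1 ZY1)).
  rewrite -[X in (sqrte X * _)%E](fineK (variance_fin_num Z2)).
  rewrite -[X in (_ * sqrte X)%E](fineK (variance_fin_num Y2)).
  by rewrite /= -EFinM lee_fin sqrtrM// fine_ge0// variance_ge0.
have := cov_le X X2 XY1.
have := cov_le (\- X)%R.
rewrite covarianceNl// varianceN// fineN => NXY_le XY_le.
have [NX2 NXY1] : (\- X)%R \in Lfun P 2%:E /\ ((\- X) * Y)%R \in Lfun P 1.
  by split; [rewrite rpredN|rewrite mulNr rpredN].
have := NXY_le NX2 NXY1.
set c := fine _ in XY_le *; set v := _ * _ in XY_le *.
have v0 : 0 <= v by rewrite mulr_ge0// fine_ge0// variance_ge0.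
move=> c_le; have s0 := sqrtr_ge0 v; rewrite -(sqr_sqrtr v0); nra.
Qed.

(** Let [Y] be the sum of the likelihood ratios over [A], of null mean [#|A|]. The summed mean
    shifts are the null covariance of [q] and [Y], and the double sum is the variance of [Y]. *)
Lemma detection_cauchy_schwarz (R : realType) n (I : finType) (A : {set I})
    (theta : I -> vec R n) (b : R) q : @queries R n b q ->
  (\sum_(i in A) (fine 'E_(gaussian (theta i))[q]%E
                  - fine 'E_(null_law R n)[q]%E)) ^+ 2 <=
  fine 'V_(null_law R n)[q]%E *
  \sum_(i in A) \sum_(j in A) (expR (dotp (theta i) (theta j)) - 1).
Proof.
move=> Qq; pose P := null_law R n.
pose L i : vec R n -> R := likelihood_ratio (theta i).
have L2 i : L i \in Lfun P 2%:E by exact: likelihood_ratio_Lfun2.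
have L1 i := probability_Lfun12 (L2 i).
pose Y : vec R n -> R := \sum_(i in A) L i.
have Y2 : Y \in Lfun P 2%:E.
  by apply: rpred_sum => [|? i _]; [exact: lee1n|exact: L2].
have q2 := query_Lfun2 P Qq.
have Y1 := probability_Lfun12 Y2; have q1 := probability_Lfun12 q2.
have EY : ('E_P[Y] = #|A|%:R%:E)%E.
  rewrite expectation_big//.
  under eq_bigr do rewrite expectation_likelihood_ratio.
  by rewrite sumEFin sumr_const.
have EqY : ('E_P[q * Y]%R =
    (\sum_(i in A) fine 'E_(gaussian (theta i))[q])%:E)%E.
  rewrite (_ : (q * Y)%R = \sum_(i in A) (q \* L i)%R); last first.
    by rewrite mulr_sumr.
  rewrite expectation_big; last by move=> i; exact: Lfun2_mul_Lfun1.
  rewrite -sumEFin; apply: eq_bigr => i _.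
  rewrite -(expectation_gaussian _ Qq) fineK// expectation_fin_num//.
  exact: probability_Lfun12 (query_Lfun2 _ Qq).
have EYY : ('E_P[Y * Y]%R =
    (\sum_(i in A) \sum_(j in A) expR (dotp (theta i) (theta j)))%:E)%E.
  have -> : (Y * Y)%R = \sum_(i in A) \sum_(j in A) (L i \* L j)%R.
    by rewrite mulr_suml; apply: eq_bigr => i _; rewrite mulr_sumr.
  rewrite expectation_big; last first.
    move=> i; apply: rpred_sum => j _.
    exact: (Lfun2_mul_Lfun1 (L2 i) (L2 j)).
  rewrite -sumEFin; apply: eq_bigr => i _.
  rewrite expectation_big; last by move=> j; exact: Lfun2_mul_Lfun1.
  rewrite -sumEFin; apply: eq_bigr => j _.
  exact: expectation_likelihood_ratioM.
have -> : \sum_(i in A) (fine 'E_(gaussian (theta i))[q]%E - fine 'E_P[q]%E) =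
    fine (covariance P q Y).
  rewrite covarianceE ?Lfun2_mul_Lfun1// EqY EY.
  rewrite -(fineK (expectation_fin_num q1)).
  by rewrite sumrB sumr_const /= mulr_natr.
have -> : \sum_(i in A) \sum_(j in A) (expR (dotp (theta i) (theta j)) - 1) =
    fine 'V_P[Y]%E.
  rewrite /variance covarianceE ?Lfun2_mul_Lfun1// EYY EY /=.
  under eq_bigr do rewrite sumrB sumr_const.
  by rewrite sumrB sumr_const mulr_natr.
exact: covariance_sqr_le.
Qed.

(** * Mean shifts under the mixture alternative *)

(** Additivity in the measure is applied to the nonnegative [q + b]. The shift by [b] is then
    removed, the weights summing to 1. *)
Lemma expectation_mixture (R : realType) n (a : {i01 R})
    (P Q : probability (vec R n) R) (b : R) q : @queries R n b q ->
  ('E_(mixture a P Q)[q] =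
   (1 - a%:num)%:E * 'E_P[q] + a%:num%:E * 'E_Q[q])%E.
Proof.
move=> Qq; have [mq qb] := Qq.
have q1 (M : probability (vec R n) R) := probability_Lfun12 (query_Lfun2 M Qq).
have shift (M : probability (vec R n) R) :
    ('E_M[(q \+ cst b)%R] = 'E_M[q] + b%:E)%E.
  by rewrite expectationD ?Lfun_cst// expectation_cst.
have mqb : measurable_fun setT (fun x => ((q \+ cst b) x)%:E).
  by apply/measurable_EFinP; exact: measurable_funD.
have qb0 x : (0 <= ((q \+ cst b) x)%:E)%E.
  by have /andP[? ?] := qb x; rewrite lee_fin/=; lra.
have mixE : ('E_(mixture a P Q)[(q \+ cst b)%R] =
    (1 - a%:num)%:E * 'E_P[(q \+ cst b)%R]
    + a%:num%:E * 'E_Q[(q \+ cst b)%R])%E.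
  rewrite unlock.
  transitivity (\int[measure_add (mscale ((1 - a%:num)%:nng)%R P)
                                 (mscale (a%:num%:nng)%R Q)]_x
     ((q \+ cst b) x)%:E)%E; first by [].
  by rewrite ge0_integral_measure_add// !ge0_integral_mscale.
have finE (M : probability (vec R n) R) : ('E_M[q] = (fine 'E_M[q])%:E)%E.
  by rewrite fineK ?expectation_fin_num.
move: mixE; rewrite !shift (finE P) (finE Q) (finE (mixture a P Q)).
rewrite -!EFinD => -[mixE]; congr EFin.
by apply: (addIr b); rewrite mixE; ring.
Qed.

Lemma expectation_alt_law (R : realType) n (alpha : {i01 R}) (beta : R)
    (S : {set 'I_n}) (b : R) q : @queries R n b q ->
  ('E_(alt_law alpha beta S)[q] - 'E_(null_law R n)[q] =
   (alpha%:num * (fine 'E_(gaussian (shifted_mean beta S))[q]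
                  - fine 'E_(null_law R n)[q]))%:E)%E.
Proof.
move=> Qq; rewrite (expectation_mixture _ _ _ Qq).
have finE (M : probability (vec R n) R) : ('E_M[q] = (fine 'E_M[q])%:E)%E.
  rewrite fineK// expectation_fin_num// probability_Lfun12//.
  exact: query_Lfun2 Qq.
rewrite (finE (null_law R n)) (finE (gaussian (shifted_mean beta S))) /=.
by congr EFin; ring.
Qed.

Lemma dotp_shifted_mean (R : realType) n (beta : R) (S S' : {set 'I_n}) :
  dotp (shifted_mean beta S) (shifted_mean beta S') =
  beta ^+ 2 * #|S :&: S'|%:R.
Proof.
rewrite /dotp mulr_natr -sumr_const [RHS]big_mkcond; apply: eq_bigr => i _.
rewrite !tnth_mktuple !inE.
by case: (i \in S); case: (i \in S'); rewrite /= ?mulr0 ?mul0r.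
Qed.

(** * Truncation of the overlap and the count of distinguished matchings *)

(** With [y = beta ^+ 2 * F], the bound [expR y - 1 <= y * expR y] extracts [beta ^+ 2], and
    [F * expR y] is at most [X = expR (2 * F)]. The power [X ^+ r.+1] is a constant raised to the
    power [F], a form whose sum over matchings is already bounded; [u ^+ r] in the denominator is
    the gain. *)
Lemma expR_sub1_le (R : realType) (beta u : R) (F r : nat) :
  0 <= beta <= 1 -> 0 < u ->
  expR (beta ^+ 2 * F%:R) - 1 <=
  beta ^+ 2 * (u + expR (2 * r.+1%:R) ^+ F / u ^+ r).
Proof.
move=> /andP[b0 b1] u0.
have b2 : 0 <= beta ^+ 2 <= 1 by rewrite sqr_ge0 expr_le1.
set y := beta ^+ 2 * F%:R.
have yF : y <= F%:R by rewrite ler_piMl//; case/andP: b2.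
have exp_sub1 : expR y - 1 <= y * expR y.
  have := expR_ge1Dx (- y); rewrite expRN => h.
  have : (1 - y) * expR y <= 1 by rewrite -ler_pdivlMr ?expR_gt0// div1r.
  lra.
apply: le_trans exp_sub1 _; rewrite /y -mulrA ler_wpM2l ?sqr_ge0//.
have Xr : expR (2 * r.+1%:R) ^+ F = expR (2 * F%:R) ^+ r.+1 :> R.
  by rewrite -!expRM_natr; congr expR; ring.
have FX : F%:R * expR y <= expR (2 * F%:R).
  rewrite [2 * _](_ : _ = F%:R + F%:R); last by ring.
  rewrite expRD ler_pM// ?expR_ge0 ?ler_expR//.
  by apply: le_trans (expR_ge1Dx _); rewrite lerDr.
apply: le_trans FX _; rewrite Xr; set X := expR (2 * F%:R).
have X0 : 0 < X by exact: expR_gt0.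
(* The truncation [X <= u + X ^+ r.+1 / u ^+ r]. *)
have [Xu|uX] := leP X u.
  apply: le_trans Xu _.
  by rewrite lerDl divr_ge0// exprn_ge0 ?(ltW X0) ?(ltW u0).
rewrite exprS -mulrA -expr_div_n; apply: le_trans (_ : X * (X / u) ^+ r <= _).
  by rewrite ler_peMr ?(ltW X0)// exprn_ege1// ler_pdivlMr// mul1r ltW.
by rewrite lerDr ltW.
Qed.

(** Only the truncated part [u] is counted over [A]. The nonnegative tail terms are summed over all
    matchings, where the exponential moment with [z + 1 = expR (2 * r.+1)] applies. *)
Lemma sum_expR_sub1_le (R : realType) m (A : {set {set 'I_(m ^ 2)}})
    (S : {set 'I_(m ^ 2)}) (beta u : R) (r : nat) :
  0 <= beta <= 1 -> 0 < u -> A \subset perfect_matchings m ->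
  S \in perfect_matchings m ->
  \sum_(S' in A) (expR (beta ^+ 2 * #|S :&: S'|%:R) - 1) <=
  beta ^+ 2 * (u * #|A|%:R +
    #|perfect_matchings m|%:R * expR (expR (2 * r.+1%:R) - 1) / u ^+ r).
Proof.
move=> b01 u0 AM SM.
apply: le_trans (ler_sum _ (fun S' _ => expR_sub1_le #|S :&: S'| r b01 u0)) _.
rewrite -mulr_sumr ler_wpM2l ?sqr_ge0// big_split/= sumr_const.
rewrite -[u *+ _]mulr_natr lerD2l -mulr_suml.
rewrite ler_wpM2r ?invr_ge0 ?exprn_ge0 ?(ltW u0)//.
have E1 : 0 <= expR (2 * r.+1%:R) - 1 :> R.
  by rewrite subr_ge0 -expR0 ler_expR mulr_ge0.
apply: le_trans (sum_expr_matchingI SM E1); rewrite subrK.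
rewrite [leRHS](big_setID A)/= (finset.setIidPr AM) lerDl.
by apply: sumr_ge0 => S' _; rewrite exprn_ge0// expR_ge0.
Qed.

(** Here [s] is the sign of the shifts, [t] stands for the threshold of [q] and [x] for the square
    of tau. Bounding the squared total shift from both sides gives
    [2 * (u * N) < u * N + K / u ^+ r]. The 2 under the square root in the threshold is what leaves
    [u * N] after subtraction. *)
Lemma one_sided_distinguished_le (R : realType) m (A : {set {set 'I_(m ^ 2)}})
    (b : R) q (s alpha beta u x t : R) (r : nat) :
  @queries R (m ^ 2) b q -> 0 <= alpha -> 0 <= beta <= 1 -> 0 < u ->
  A \subset perfect_matchings m ->
  0 <= t -> 2 * fine 'V_(null_law R (m ^ 2))[q]%E * x <= t ^+ 2 ->
  alpha ^+ 2 * beta ^+ 2 * u <= x -> s ^+ 2 = 1 ->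
  (forall S, S \in A -> t < s * (alpha *
     (fine 'E_(gaussian (shifted_mean beta S))[q]%E
      - fine 'E_(null_law R (m ^ 2))[q]%E))) ->
  #|A|%:R * u ^+ r.+1 <=
  #|perfect_matchings m|%:R * expR (expR (2 * r.+1%:R) - 1).
Proof.
move=> Qq a0 b01 u0 AM t0 tV xu s1 At.
set N : R := #|A|%:R; set K := _ * expR _.
have K0 : 0 <= K by rewrite mulr_ge0// expR_ge0.
(* A member of [A] is needed for the summed inequality [tD] to be strict. *)
have [A0|[S0 S0A]] := set_0Vmem A.
  by rewrite /N A0 cards0 mul0r.
have N0 : 0 < N by rewrite ltr0n card_gt0; apply/finset.set0Pn; exists S0.
have := @detection_cauchy_schwarz R (m ^ 2) _ A (shifted_mean beta) b q Qq.
set V := fine 'V_(_)[_]%E in tV *; set D := (X in X ^+ 2 <= _).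
set W := (X in _ <= _ * X) => DVW.
have V0 : 0 <= V by rewrite fine_ge0// variance_ge0.
have tD : N * t < s * alpha * D.
  rewrite -mulrA /D !mulr_sumr /N mulr_natl -sumr_const.
  by apply: ltr_sum => //; apply/hasP; exists S0; rewrite ?mem_index_enum.
have W_le : W <= N * (beta ^+ 2 * (u * N + K / u ^+ r)).
  rewrite /W /N mulr_natl -sumr_const; apply: ler_sum => S SA.
  under eq_bigr do rewrite dotp_shifted_mean.
  by apply: sum_expR_sub1_le => //; exact: (fintype.subsetP AM).
set c := alpha ^+ 2 * beta ^+ 2 in xu.
have c0 : 0 <= c by rewrite mulr_ge0// sqr_ge0.
have Nt0 : 0 <= N * t by rewrite mulr_ge0// (ltW N0).
have sqr_lt : (N * t) ^+ 2 < alpha ^+ 2 * D ^+ 2.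
  rewrite -[ltRHS]mul1r -s1 mulrA -!exprMn ltr_sqr ?nnegrE//.
  exact: ltW (le_lt_trans Nt0 tD).
have lower : c * V * N * (2 * (u * N)) <= (N * t) ^+ 2.
  rewrite exprMn; apply: le_trans (_ : N ^+ 2 * (2 * V * x) <= _); last first.
    by rewrite ler_wpM2l// sqr_ge0.
  rewrite [leLHS](_ : _ = N ^+ 2 * (2 * V) * (c * u)); last by ring.
  by rewrite [leRHS]mulrA ler_wpM2l// !mulr_ge0// sqr_ge0.
have upper : alpha ^+ 2 * D ^+ 2 <= c * V * N * (u * N + K / u ^+ r).
  rewrite [leRHS](_ : _ =
    alpha ^+ 2 * (V * (N * (beta ^+ 2 * (u * N + K / u ^+ r))))).
    by rewrite ler_wpM2l ?sqr_ge0//; apply: le_trans DVW _; rewrite ler_wpM2l.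
  by rewrite /c; ring.
have cVN0 : 0 <= c * V * N := mulr_ge0 (mulr_ge0 c0 V0) (ltW N0).
(* The common factor [c * V * N] may vanish, so it is not divided out: multiplying the reverse
   inequality by it contradicts the strict [sqr_lt]. *)
have uN_lt : 2 * (u * N) < u * N + K / u ^+ r.
  rewrite ltNge; apply/negP => le2; have := ler_wpM2l cVN0 le2.
  apply/negP; rewrite -ltNge.
  exact: le_lt_trans lower (lt_le_trans sqr_lt upper).
rewrite exprS mulrA -ler_pdivlMr ?exprn_gt0// [N * u]mulrC; lra.
Qed.

(** The one-sided bound is applied separately to the matchings with upward and with downward shift,
    whence the factor 2. *)
Lemma distinguished_le (R : realType) m (b : R) n (xi : R) (alpha : {i01 R})
    (beta u : R) (r : nat) q :
  @queries R (m ^ 2) b q -> 0 <= b -> 0 <= beta <= 1 -> 0 <= xi <= 1 -> 0 < u ->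
  (xi != 0 -> alpha%:num ^+ 2 * beta ^+ 2 * u <= ln xi^-1 / n%:R) ->
  #|distinguished b n xi alpha beta q|%:R * u ^+ r.+1 <=
  2 * (#|perfect_matchings m|%:R * expR (expR (2 * r.+1%:R) - 1)).
Proof.
move=> Qq b0 b01 /andP[xi0 xi1] u0 xu.
set K := #|perfect_matchings m|%:R * _.
have K0 : 0 <= K by rewrite mulr_ge0// expR_ge0.
(* For [xi = 0] the threshold is infinite and no matching is distinguished. *)
have [xi_eq0|xi_neq0] := eqVneq xi 0.
  have -> : distinguished b n xi alpha beta q = finset.set0.
    apply/setP => S; rewrite !inE /tau_query xi_eq0 eqxx.
    by apply/andP => -[_]; rewrite ltNge leey.
  by rewrite cards0 mul0r mulr_ge0.
have {}xu := xu xi_neq0.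
have x0 : 0 <= ln xi^-1 / n%:R.
  by rewrite divr_ge0// ln_ge0// invf_ge1// lt0r xi_neq0.
set x := ln _ / _ in xu x0.
pose t : R := Num.max (2 * b / 3 * x)
  (Num.sqrt (2 * fine 'V_(null_law R (m ^ 2))[q]%E * ln xi^-1 / n%:R)).
have t0 : 0 <= t by rewrite le_max sqrtr_ge0 orbT.
have tV : 2 * fine 'V_(null_law R (m ^ 2))[q]%E * x <= t ^+ 2.
  have V0 : 0 <= fine 'V_(null_law R (m ^ 2))[q]%E.
    by rewrite fine_ge0// variance_ge0.
  have Vx0 := mulr_ge0 (mulr_ge0 (ler0n R 2) V0) x0.
  rewrite -[leLHS](sqr_sqrtr Vx0) /x mulrA.
  by rewrite ler_sqr ?nnegrE ?sqrtr_ge0// le_max lexx orbT.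
pose D S := alpha%:num * (fine 'E_(gaussian (shifted_mean beta S))[q]%E
      - fine 'E_(null_law R (m ^ 2))[q]%E).
have mem_dist S : (S \in distinguished b n xi alpha beta q) =
    (S \in perfect_matchings m) && (t < `|D S|).
  rewrite !inE; congr (_ && _).
  by rewrite /tau_query (negPf xi_neq0) (expectation_alt_law _ _ _ Qq) lte_fin.
pose A (s : R) := [set S in perfect_matchings m | t < s * D S]%SET.
have A_le s : s ^+ 2 = 1 -> #|A s|%:R * u ^+ r.+1 <= K.
  move=> s1.
  apply: (one_sided_distinguished_le r Qq _ b01 u0 _ t0 tV xu s1) => //.
    by apply/fintype.subsetP => S; rewrite inE => /andP[].
  by move=> S; rewrite inE => /andP[].
have dist_sub : distinguished b n xi alpha beta q \subset (A 1 :|: A (-1))%SET.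
  apply/fintype.subsetP => S; rewrite mem_dist !inE => /andP[-> /=].
  by rewrite mul1r mulN1r ltr_normr.
have card_le :
    (#|distinguished b n xi alpha beta q| <= #|A 1%R| + #|A (-1)%R|)%N.
  by apply: leq_trans (subset_leq_card dist_sub) _; rewrite cardsU leq_subr.
rewrite [leRHS]mulr_natl mulr2n.
apply: le_trans (lerD (A_le 1 _) (A_le (-1) _)).
- by rewrite -mulrDl -natrD ler_wpM2r ?ler_nat// exprn_ge0 ?(ltW u0).
- by rewrite expr1n.
- by rewrite sqrrN expr1n.
Qed.

Lemma sup_distinguished_le (R : realType) m (b : R) n (xi : R) (alpha : {i01 R})
    (beta u : R) (r : nat) :
  0 < b -> 0 <= beta <= 1 -> 0 <= xi <= 1 -> 0 < u ->
  (xi != 0 -> alpha%:num ^+ 2 * beta ^+ 2 * u <= ln xi^-1 / n%:R) ->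
  0 <= sup_distinguished m b n xi alpha beta / #|perfect_matchings m|%:R <=
  2 * expR (expR (2 * r.+1%:R) - 1) / u ^+ r.+1.
Proof.
move=> b0 b01 xi01 u0 xu.
have M0 : 0 < #|perfect_matchings m|%:R :> R.
  by rewrite card_perfect_matchings ltr0n fact_gt0.
have bound q : @queries R (m ^ 2) b q ->
    #|distinguished b n xi alpha beta q|%:R <=
    2 * expR (expR (2 * r.+1%:R) - 1) / u ^+ r.+1 * #|perfect_matchings m|%:R.
  move=> Qq; rewrite mulrAC ler_pdivlMr ?exprn_gt0// -mulrA.
  by rewrite [expR _ * _]mulrC; exact: distinguished_le (ltW b0) b01 xi01 u0 xu.
(* The zero query makes the set of counts nonempty, as the upper bound on [sup] requires, and its
   count bounds [sup] below by a nonnegative number. *)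
pose q0 : vec R (m ^ 2) -> R := cst 0.
have Q0 : @queries R (m ^ 2) b q0.
  by split; [exact: measurable_cst|move=> x; rewrite /q0/=; lra].
have count0 : [set #|distinguished b n xi alpha beta q|%:R |
                 q in @queries R (m ^ 2) b]
    (#|distinguished b n xi alpha beta q0|%:R : R) by exists q0.
rewrite divr_ge0 ?(ltW M0)//=.
  rewrite ler_pdivrMr//; apply: ge_sup => [|_ [q Qq <-]]; last exact: bound.
  by eexists; exact: count0.
apply: le_trans (ub_le_sup _ count0) => //.
by eexists => _ [q Qq <-]; exact: bound.
Qed.

(** * Asymptotics in the two settings *)

Lemma near_sqr_powR_ge1 (R : realType) (delta : R) : 0 <= delta ->
  \forall m \near \oo, 1 <= (m ^ 2)%N%:R `^ delta :> R.
Proof.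
move=> d0; near=> m.
rewrite -[leLHS](powRr0 (m ^ 2)%N%:R) ler_powR//.
by rewrite ler1n expn_gt0; apply/orP; left; near: m; exact: nbhs_infty_gt.
Unshelve. all: by end_near. Qed.

(* All sequences are indexed by m = sqrt d, i.e., d = m ^ 2. *)
Theorem theorem5p7 (R : realType) :
  exists2 delta0 : R, 0 < delta0 &
  forall (delta : R), 0 < delta < delta0 ->
  forall (b : R) (n : nat -> nat) (alpha : nat -> {i01 R})
    (beta xi T : nat -> R) (eta : R),
  0 < b ->
  (forall m, 0 < (alpha m)%:num) ->
  (forall m, 0 < beta m) ->
  (forall m, 0 <= xi m < 4^-1) ->
  n m @[m --> \oo] --> \oo ->
  (alpha m)%:num * (n m)%:R @[m --> \oo] --> +oo ->
  beta m @[m --> \oo] --> 0 ->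
  (forall m, 1 <= T m) ->
  T =O_\oo (fun m => (m ^ 2)%N%:R `^ eta) ->
  let t m := tau (n m) (xi m) in
  ((t m ^+ 2 / ((alpha m)%:num ^+ 2)%:E)%E @[m --> \oo] --> 0%E /\
   (t m ^+ 2 / (2 * (m ^ 2)%N%:R `^ delta * (alpha m)%:num ^+ 2
                  * beta m ^+ 2)%:E)%E @[m --> \oo] --> +oo%E)
  \/
  ((exists l : \bar R,
     (t m ^+ 2 / ((alpha m)%:num ^+ 2)%:E)%E @[m --> \oo] --> l /\
     (0 < l)%E) /\
   beta =o_\oo (fun m => (m ^ 2)%N%:R `^ (- delta))) ->
  T m * sup_distinguished m b (n m) (xi m) (alpha m) (beta m)
    / #|perfect_matchings m|%:R @[m --> \oo] --> 0.
Proof.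
exists 1 => // delta /andP[d0 _] b n alpha beta xi T eta b0 a0 beta0 xi4 _ _.
move=> beta_cvg T1 TO t settings.
pose u m : R := (m ^ 2)%N%:R `^ delta.
(* This is the square of tau only if [xi m != 0]. At 0 the defaults of inverse and logarithm give
   [x m = 0] while tau is infinite, hence the guards below. *)
pose x m : R := ln (xi m)^-1 / (n m)%:R.
have xi01 m : 0 <= xi m <= 1.
  by have /andP[? ?] := xi4 m; apply/andP; split; lra.
have x0 m : xi m != 0 -> 0 <= x m.
  move=> xim; have /andP[xi0 xi1] := xi01 m.
  by rewrite divr_ge0// ln_ge0// invf_ge1// lt0r xim.
have tE m : xi m != 0 -> (t m ^+ 2 = (x m)%:E)%E.
  by move=> xim; rewrite /t /tau (negPf xim) -EFin_expe sqr_sqrtr// x0.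
have u_gt0 : \forall m \near \oo, 0 < u m.
  apply: filterS (near_sqr_powR_ge1 (ltW d0)) => m.
  exact: lt_le_trans ltr01.
have tau_ge : \forall m \near \oo,
    xi m != 0 -> (alpha m)%:num ^+ 2 * beta m ^+ 2 * u m <= x m.
  have a2_gt0 m : 0 < (alpha m)%:num ^+ 2 by rewrite exprn_gt0.
  have div_ge (v w : R) m : 0 < w -> xi m != 0 ->
      (v%:E <= t m ^+ 2 / w%:E)%E -> v * w <= x m.
    by move=> w0 xim; rewrite inver gt_eqF// lee_pdivlMr// tE.
  (* In setting (i) the diverging ratio is eventually at least 1, which gives the claim with a
     factor 2 to spare. *)
  case: settings => [[_ /cvgeyPge/(_ 1) big]|[[l [tl l0]] /eqoP beta_o]].
    near=> m; move=> xim; have um : 0 < u m by near: m.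
    have w0 : 0 < 2 * u m * (alpha m)%:num ^+ 2 * beta m ^+ 2.
      by rewrite !mulr_gt0// exprn_gt0.
    have := div_ge 1 _ _ w0 xim; rewrite mul1r => x_ge.
    apply: le_trans (x_ge _); last by near: m.
    rewrite [leRHS](_ : _ =
      2 * ((alpha m)%:num ^+ 2 * beta m ^+ 2 * u m)); last by ring.
    by rewrite ler_peMl ?ler1n// !mulr_ge0 ?sqr_ge0// ltW.
  (* As [l] may be infinite, a positive real [c] below it serves as the eventual lower bound. *)
  have [c c0 cl] : exists2 c : R, 0 < c & (c%:E < l)%E.
    case: l l0 {tl} => [l|_|//]; last by exists 1; rewrite ?ltry.
    rewrite lte_fin => l0; exists (l / 2); rewrite ?divr_gt0//.
    by rewrite lte_fin ltr_pdivrMr// ltr_pMr// ltr1n.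
  (* Once [beta * u] is at most [Num.min 1 c] and [u >= 1], one gets [beta <= beta * u <= 1], so
     [beta ^+ 2 * u <= beta * u <= c]. *)
  have e0 : 0 < Num.min 1 c by rewrite lt_min ltr01.
  have c_lt : \forall m \near \oo,
      (c%:E < t m ^+ 2 / ((alpha m)%:num ^+ 2)%:E)%E.
    exact: (tl _ (open_ereal_gt' cl)).
  have beta_le := beta_o _ e0.
  near=> m; move=> xim.
  have um1 : 1 <= u m by near: m; exact: near_sqr_powR_ge1 (ltW d0).
  have bu : beta m * u m <= Num.min 1 c.
    have um : 0 < u m by near: m.
    have : `|beta m| <= Num.min 1 c * `|(m ^ 2)%N%:R `^ (- delta)| by near: m.
    rewrite (ger0_norm (ltW (beta0 m))) ger0_norm ?powR_ge0// powRN.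
    by rewrite ler_pdivlMr.
  have : c * (alpha m)%:num ^+ 2 <= x m.
    by apply: div_ge => //; apply: ltW; near: m.
  apply: le_trans; rewrite -mulrA mulrC ler_wpM2r ?(ltW (a2_gt0 m))//.
  move: bu; rewrite le_min => /andP[bu1 buc]; apply: le_trans buc.
  have bm0 := beta0 m.
  have bm1 : beta m <= beta m * u m by rewrite ler_peMr// ltW.
  rewrite expr2 mulrAC ler_piMr ?(le_trans bm1)// mulr_ge0 ?(ltW bm0)//; lra.
have beta1 : \forall m \near \oo, beta m <= 1.
  move/cvgrPdist_le : beta_cvg => /(_ 1 ltr01); apply: filterS => m.
  by rewrite sub0r normrN ger0_norm// ltW.
have [K K0 TK] : exists2 K : R, 0 < K &
    \forall m \near \oo, T m <= K * (m ^ 2)%N%:R `^ eta.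
  move/eqO_exP : TO => [K K0 TK]; exists K => //; apply: filterS TK => m.
  by rewrite [`|_ `^ _|]ger0_norm ?powR_ge0//; apply: le_trans; exact: ler_norm.
(* This choice makes [u ^+ r.+1] at least [d^(eta + 1)], so it beats the growth of [T] by a full
   factor [d]. *)
have [r hr] : exists r : nat, eta + 1 <= delta * r.+1%:R.
  exists (Num.bound `|(eta + 1) / delta|); rewrite mulrC -ler_pdivrMr//.
  apply: le_trans (ler_norm _) (ltW (lt_trans (archi_boundP (normr_ge0 _)) _)).
  by rewrite ltr_nat.
pose C : R := 2 * expR (expR (2 * r.+1%:R) - 1).
have C0 : 0 < C by rewrite mulr_gt0// expR_gt0.
(* The spare factor [d = m ^ 2] is at least [m.+1] as soon as [m > 1], and [harmonic m] is the
   inverse of [m.+1]. *)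
apply: (@squeeze_cvgr _ _ _ _ (cst 0) (fun m => K * C * harmonic m)).
- near=> m.
  have um : 0 < u m by near: m.
  have b01 : 0 <= beta m <= 1 by rewrite (ltW (beta0 m))/=; near: m.
  have m1 : (1 < m)%N by near: m; exact: nbhs_infty_gt.
  have xu : xi m != 0 -> (alpha m)%:num ^+ 2 * beta m ^+ 2 * u m <= x m.
    by near: m.
  have /andP[s0 s_le] :=
    @sup_distinguished_le R m b (n m) _ _ _ _ r b0 b01 (xi01 m) um xu.
  have T0 : 0 <= T m by apply: le_trans (T1 m).
  rewrite -mulrA mulr_ge0//=.
  apply: le_trans (ler_wpM2l T0 s_le) _; rewrite -/C.
  have d_gt1 : 1 <= (m ^ 2)%N%:R :> R by rewrite ler1n expn_gt0 (ltnW m1).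
  have d_gt0 : 0 < (m ^ 2)%N%:R :> R := lt_le_trans ltr01 d_gt1.
  have u_powE : u m ^+ r.+1 = (m ^ 2)%N%:R `^ (delta * r.+1%:R).
    by rewrite -powR_mulrn ?(ltW um)// -powRrM.
  have eta_le : (m ^ 2)%N%:R `^ eta * (m ^ 2)%N%:R <= u m ^+ r.+1.
    rewrite u_powE -[X in _ * X](powRr1 (ltW d_gt0)).
    by rewrite -powRD ?(gt_eqF d_gt0) ?implybT// ler_powR.
  have Tm : T m <= K * (m ^ 2)%N%:R `^ eta by near: m.
  rewrite mulrA ler_pdivrMr ?exprn_gt0//.
  apply: le_trans (ler_wpM2r (ltW C0) Tm) _.
  rewrite mulrAC -[leRHS]mulrA ler_wpM2l ?(ltW (mulr_gt0 K0 C0))//.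
  rewrite /harmonic /= ler_pdivlMl ?ltr0n// mulrC; apply: le_trans eta_le.
  rewrite ler_wpM2l ?powR_ge0// ler_nat -mulnn.
  apply: (@leq_trans (m * 2)); last by rewrite leq_mul2l m1 orbT.
  by rewrite muln2 -addnn -addn1 leq_add2l ltnW.
- exact: cvg_cst.
- rewrite -[X in _ --> X](mulr0 (K * C)).
  by apply: cvgM; [exact: cvg_cst|exact: cvg_harmonic].
Unshelve. all: by end_near. Qed.
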